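(* Let $q$ be a prime power and $n\ge 3$, and let $X_q(n,1)$ be the graph whose vertices are the lines of the affine space $\operatorname{AG}(n,q)$, two distinct lines being adjacent if and only if they intersect. Then $-q$ is an eigenvalue of $X_q(n,1)$, every $-q$-eigenfunction has at least $2q$ nonzero values (the weight-distribution bound), and this bound is tight: there exist $-q$-eigenfunctions with exactly $2q$ nonzero values. Moreover, there are exactly two types of optimal $-q$-eigenfunctions: there is a one-to-one correspondence between optimal eigenfunctions of the first type and pairs of parallel classes of lines of some affine plane $\operatorname{AG}(2,q)$ contained in $\operatorname{AG}(n,q)$, and a one-to-one correspondence between optimal eigenfunctions of the second type and affine reguli in $3$-dimensional subspaces of $\operatorname{AG}(n,q)$. Explicitly, $f$ is an optimal $-q$-eigenfunction if and only if there is $c\ne 0$ such that either (first type) $f=c$ on the $q$ lines of one parallel class of an affine plane $P\subseteq \operatorname{AG}(n,q)$, $f=-c$ on the $q$ lines of a different parallel class of $P$, and $f=0$ elsewhere; or (second type) $f=c$ on the lines of an affine regulus $R$ contained in some $3$-dimensional affine subspace, $f=-c$ on the lines of its opposite affine regulus $R^{opp}$, and $f=0$ elsewhere.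
   Context: $\operatorname{AG}(n,q)$ is the geometry whose points, lines, planes, ... are the cosets of the subspaces of dimension $0,1,2,\dots$ of an $n$-dimensional vector space over $\mathbb{F}_q$. For a graph $G$ and an eigenvalue $\theta$, a $\theta$-eigenfunction is a real-valued function $f\not\equiv 0$ on $V(G)$ with $\theta f(u)=\sum_{w\sim u}f(w)$ for every vertex $u$; it is optimal if it has the minimum number of nonzero values among all $\theta$-eigenfunctions. Two affine lines are parallel if they are cosets of the same $1$-dimensional subspace, and skew if they are disjoint and not parallel. A transversal of a set $S$ of pairwise skew lines is a line meeting each line of $S$ in exactly one point. In a $3$-dimensional affine space, an affine regulus is a nonempty set $R$ of pairwise skew lines such that (1) through each point of each line of $R$ there is a transversal of $R$, and (2) through each point of a transversal of $R$ there is a line of $R$; the set $R^{opp}$ of all transversals of $R$ is again an affine regulus, called the opposite affine regulus.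
   Formalization: For q=2 the transversals of a regulus R do not form a regulus and the claim fails; there R^opp is replaced by a regulus R' contained in the set of transversals, with pairs (R,R'). Correspondences are with eigenfunctions up to positive scalars and ordered pairs of parallel classes. *)

(* Defs.v *)
From HB Require Import structures.
From mathcomp Require Import all_boot all_order all_algebra.
From mathcomp Require Import all_classical reals.

Set Implicit Arguments.
Unset Strict Implicit.
Unset Printing Implicit Defensive.

Import Order.TTheory GRing.Theory Num.Theory.
Local Open Scope ring_scope.

Section Eigenfunctions.
Variables (R : realType) (V : finType) (adj : rel V).

Definition adjacency_matrix : 'M[R]_#|V| :=
  \matrix_(i, j) (adj (enum_val i) (enum_val j))%:R.

Definition eigenfunction (theta : R) (f : {ffun V -> R}) : Prop :=
  (exists u, f u != 0) /\
  forall u, theta * f u = \sum_(w | adj u w) f w.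

Definition weight (f : {ffun V -> R}) : nat := #|[pred u | f u != 0]|.

Definition optimal_eigenfunction (theta : R) (f : {ffun V -> R}) : Prop :=
  eigenfunction theta f /\
  forall g, eigenfunction theta g -> (weight f <= weight g)%N.

(* [takes_values c A B f]: f is c on A, -c on B and 0 elsewhere. *)
Definition takes_values (c : R) (A B : {set V}) (f : {ffun V -> R}) : Prop :=
  [/\ forall u, u \in A -> f u = c,
      forall u, u \in B -> f u = - c
    & forall u, u \notin A -> u \notin B -> f u = 0].

Definition signed_indicator (A B : {set V}) : {ffun V -> R} :=
  [ffun u => (u \in A)%:R - (u \in B)%:R].

(* Eigenfunctions are only determined up to a scalar.  The ray of f identifies
   it with its positive multiples only: f and -f are kept apart, since negation
   exchanges the set where f is positive with the set where it is negative. *)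
Definition ray (f : {ffun V -> R}) : set {ffun V -> R} :=
  [set g | exists2 c : R, 0 < c & g = [ffun u => c * f u]]%classic.

End Eigenfunctions.

Section AffineGeometry.
Variables (F : finFieldType) (n : nat).

Local Notation point := 'rV[F]_n.

(* Subspaces of F^n are represented as row spaces of square matrices. *)
Definition coset (p : point) (U : 'M[F]_n) : {set point} :=
  [set x | (x - p <= U)%MS]%SET.

Definition is_flat (d : nat) (S : {set point}) : bool :=
  [exists p : point, exists U : 'M[F]_n, (\rank U == d) && (S == coset p U)].

Record line := Line { points : {set point}; _ : is_flat 1 points }.

HB.instance Definition _ := [isSub for points].
HB.instance Definition _ := [Finite of line by <:].

Definition line_graph : rel line :=
  fun L M => (L != M) && (points L :&: points M != finset.set0)%SET.

Definition parallel (L M : line) : bool :=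
  [exists p : point, exists p' : point, exists U : 'M[F]_n,
    [&& \rank U == 1%N, points L == coset p U & points M == coset p' U]].

Definition skew (L M : line) : bool :=
  [disjoint points L & points M] && ~~ parallel L M.

Definition pairwise_skew (S : {set line}) : Prop :=
  forall L M, L \in S -> M \in S -> L != M -> skew L M.

Definition transversals (S : {set line}) : {set line} :=
  [set T | [forall L in S, #|points T :&: points L| == 1%N]]%SET.

(* A line with two distinct points in the flat S lies in S, so for two or more
   skew lines of S it does not matter whether transversals are taken in S or in
   the whole space; one line alone is a regulus under neither reading. *)
Definition affine_regulus (S : {set point}) (R : {set line}) : Prop :=
  [/\ R != finset.set0 /\ (forall L, L \in R -> points L \subset S),
      pairwise_skew R,
      forall L p, L \in R -> p \in points L ->
        exists2 T, T \in transversals R & p \in points T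
    & forall T p, T \in transversals R -> p \in points T ->
        exists2 L, L \in R & p \in points L].

Definition affine_regulus_in_3flat (R : {set line}) : Prop :=
  exists2 S, is_flat 3 S & affine_regulus S R.

Definition opposite_regulus (R : {set line}) : {set line} := transversals R.

(* When q = 2 a regulus consists of two skew lines ab, cd and has the four
   transversals ac, ad, bc, bd, which are not pairwise skew.  The transversals
   then contain two reguli {ac, bd} and {ad, bc}, and R has to be paired with
   one of them. *)
Definition opposite_pair (R R' : {set line}) : Prop :=
  exists S, [/\ is_flat 3 S, affine_regulus S R, affine_regulus S R'
              & R' \subset transversals R].

Definition parallel_class (P : {set point}) (A : {set line}) : Prop :=
  exists2 L, points L \subset P &
    A = [set M : line | (points M \subset P) && parallel L M]%SET.

Definition distinct_parallel_classes (A B : {set line}) : Prop :=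
  exists P, [/\ is_flat 2 P, parallel_class P A, parallel_class P B & A != B].

Section Types.
Variable R : realType.
Implicit Type f : {ffun line -> R}.

Definition first_type f : Prop :=
  exists c A B,
    [/\ c != 0, distinct_parallel_classes A B & takes_values c A B f].

Definition second_type f : Prop :=
  exists c Q,
    [/\ c != 0, affine_regulus_in_3flat Q
      & takes_values c Q (opposite_regulus Q) f].

Definition second_type_binary f : Prop :=
  exists c Q Q',
    [/\ c != 0, opposite_pair Q Q' & takes_values c Q Q' f].

End Types.

End AffineGeometry.

Arguments line_graph : clear implicits.
Arguments adjacency_matrix R [V] adj.
Arguments signed_indicator R [V] A B.

(* Main.v *)
(* Writing N for the point-line incidence map, N^T N = A + q, so f is an
   eigenfunction of -q iff its values sum to 0 on the lines through each point.
   Hence every point of a line where f > 0 lies on a line where f < 0, and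
   conversely; the q points of one line give q distinct lines of the opposite
   sign, so the weight is at least 2q.  In case of equality the positive and the
   negative lines form two families of q disjoint lines, each line of one family
   meeting each of the other once, and f is constant up to sign.  If two lines of
   a family are parallel, everything lies in their plane and both families are
   parallel classes; otherwise everything lies in the 3-space of two skew lines
   and is a pair of reguli.  The surface z = xy provides such a pair. *)
Require Import Defs.
From mathcomp Require Import all_boot all_order all_algebra.
From mathcomp Require Import all_classical reals.
From mathcomp Require Import zify ring.

Set Implicit Arguments.
Unset Strict Implicit.
Unset Printing Implicit Defensive.

Import Order.TTheory GRing.Theory Num.Theory.
Local Open Scope ring_scope.

(** * Lines of the affine space: directions, incidence and parallelism *)

Section Geometry.
Variables (F : finFieldType) (n : nat).
Implicit Types (L M T : line F n) (p r x v w : 'rV[F]_n) (P S : {set 'rV[F]_n}).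

(** A line is handled through a spanning vector instead of a square matrix. The condition is imposed
    at every point of [L], so any of them may serve as base point; [v] is unique up to a nonzero
    scalar. *)
Definition direction L v : Prop :=
  v != 0 /\ forall p, p \in points L -> forall x, (x \in points L) = (x - p <= v)%MS.

Lemma mem_coset p (U : 'M[F]_n) x : (x \in coset p U) = (x - p <= U)%MS.
Proof. by rewrite inE. Qed.

Lemma coset_self p (U : 'M[F]_n) : p \in coset p U.
Proof. by rewrite mem_coset subrr sub0mx. Qed.

Lemma coset_rebase p r (U : 'M[F]_n) x :
  r \in coset p U -> (x \in coset p U) = (x - r <= U)%MS.
Proof.
rewrite !mem_coset => rU; apply/idP/idP => xU.
  by rewrite -(subrKA p) -(opprB r p) addmx_sub // eqmx_opp.
by rewrite -(subrKA r) addmx_sub.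
Qed.

Lemma coset_flat p (U : 'M[F]_n) : is_flat (\rank U) (coset p U).
Proof. by apply/existsP; exists p; apply/existsP; exists U; rewrite !eqxx. Qed.

Lemma flat_rebase d S : is_flat d S ->
  exists2 U : 'M[F]_n, \rank U = d &
    forall p, p \in S -> forall x, (x \in S) = (x - p <= U)%MS.
Proof.
case/existsP => p0 /existsP[U /andP[/eqP <- /eqP ->]].
by exists U => // p pS x; apply: coset_rebase.
Qed.

Lemma rank_row v : v != 0 -> \rank v = 1%N.
Proof. by move=> v0; rewrite rank_rV v0. Qed.

Lemma row_eqmx m (A : 'M[F]_(m, n)) v :
  \rank A = 1%N -> v != 0 -> (v <= A)%MS -> (v :=: A)%MS.
Proof.
move=> rA v0 vA; apply/eqmxP; rewrite /eqmx vA /=.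
by have := mxrank_leqif_sup vA; rewrite rA (rank_row v0) => /leqifP; case: ifP.
Qed.

Lemma coset_direction L p (U : 'M[F]_n) :
  \rank U = 1%N -> points L = coset p U -> direction L (nz_row U).
Proof.
move=> rU LE; have v0 : nz_row U != 0 by rewrite nz_row_eq0 -mxrank_eq0 rU.
split=> // r rL x; rewrite LE in rL *.
by rewrite (coset_rebase _ rL) (row_eqmx rU v0 (nz_row_sub U)).
Qed.

Lemma line_coset L : exists p, exists2 U : 'M[F]_n, \rank U = 1%N & points L = coset p U.
Proof.
case: L => S /= /[dup] fS /existsP[p /existsP[U /andP[/eqP rU /eqP ->]]].
by exists p, U.
Qed.

Lemma line_direction L : exists v, direction L v.
Proof. by have [p [U rU LE]] := line_coset L; exists (nz_row U); apply: coset_direction LE. Qed.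

Lemma line_point L : exists p, p \in points L.
Proof. by have [p [U _ LE]] := line_coset L; exists p; rewrite LE coset_self. Qed.

Lemma direction_coset L v p :
  direction L v -> p \in points L -> points L = coset p <<v>>%MS.
Proof.
by case=> _ Lv pL; apply/setP => x; rewrite mem_coset genmxE (Lv _ pL).
Qed.

Lemma parallelP L M :
  reflect (exists2 v, direction L v & direction M v) (parallel L M).
Proof.
apply: (iffP existsP) => [[p /existsP[r /existsP[U /and3P[/eqP rU /eqP LE /eqP ME]]]]|].
  by exists (nz_row U); [apply: coset_direction LE | apply: coset_direction ME].
case=> v Lv Mv; have [p pL] := line_point L; have [r rM] := line_point M.
exists p; apply/existsP; exists r; apply/existsP; exists <<v>>%MS.
rewrite -(direction_coset Lv pL) -(direction_coset Mv rM) !eqxx !andbT.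
by rewrite genmxE rank_row //; case: Lv.
Qed.

Lemma line_through p v : v != 0 -> exists2 L, p \in points L & direction L v.
Proof.
move=> v0; have rU : \rank <<v>>%MS = 1%N by rewrite genmxE rank_row.
have := coset_flat p <<v>>%MS; rewrite rU => fl.
exists (Line fl); rewrite /= ?coset_self //; split=> // r rL x.
by rewrite (coset_rebase _ rL) genmxE.
Qed.

Lemma direction_eqmx L v w : direction L v -> w != 0 -> (w <= v)%MS -> direction L w.
Proof.
case=> v0 Lv w0 wv; split=> // p pL x.
by rewrite (Lv p pL) (row_eqmx (rank_row v0) w0 wv).
Qed.

Lemma direction_sub L v w : direction L v -> direction L w -> (w <= v)%MS.
Proof.
case=> v0 Lv [w0 Lw]; have [p pL] := line_point L.
have: p + w \in points L by rewrite (Lw p pL) addrC addKr.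
by rewrite (Lv p pL) addrC addKr.
Qed.

Lemma direction_diff L p r :
  p \in points L -> r \in points L -> p != r -> direction L (r - p).
Proof.
move=> pL rL pr; have [v Lv] := line_direction L.
apply: (direction_eqmx Lv); first by rewrite subr_eq0 eq_sym.
by case: Lv => _ /(_ p pL) <-.
Qed.

Lemma line_eq L M p r : p \in points L -> r \in points L ->
  p \in points M -> r \in points M -> p != r -> L = M.
Proof.
move=> pL rL pM rM pr; apply/val_inj/setP => x /=.
have [_ /(_ _ pL) ->] := direction_diff pL rL pr.
by have [_ /(_ _ pM) ->] := direction_diff pM rM pr.
Qed.

Lemma line_meet L M p r : L != M -> p \in points L -> r \in points L ->
  p \in points M -> r \in points M -> p = r.
Proof.
by move=> LM pL rL pM rM; apply: contraNeq LM => pr; rewrite (line_eq pL rL pM rM pr).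
Qed.

Lemma card_meet L M p : L != M -> p \in points L -> p \in points M ->
  #|points L :&: points M| == 1%N.
Proof.
move=> LM pL pM; apply/cards1P; exists p; apply/setP => x; rewrite !inE.
apply/andP/eqP => [[xL xM]|->]; [exact: line_meet LM xL pL xM pM | by []].
Qed.

Lemma meet_point L M : #|points L :&: points M| == 1%N ->
  exists2 p, p \in points L & p \in points M.
Proof.
case/cards1P => p E; have: p \in points L :&: points M by rewrite E set11.
by case/setIP => pL pM; exists p.
Qed.

Lemma card_line L : #|points L| = #|F|.
Proof.
have [v Lv] := line_direction L; have [p pL] := line_point L.
have -> : points L = (fun t : F => p + t *: v) @: finset.setT.
  apply/setP => x; rewrite (Lv.2 _ pL); apply/sub_rVP/imsetP => [[t xE]|[t _ ->]].
    by exists t => //; rewrite -xE addrC subrK.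
  by exists t; rewrite addrC addKr.
rewrite card_imset ?cardsT // => s t /addrI/eqP.
by rewrite -subr_eq0 -scalerBl scaler_eq0 (negPf Lv.1) orbF subr_eq0 => /eqP.
Qed.

Lemma line_other_point L p : exists2 r, r \in points L & r != p.
Proof.
have: (0 < #|points L :\ p|)%N.
  have := card_finNzRing_gt1 F; rewrite -(card_line L) (cardsD1 p).
  by case: (p \in points L) => // /ltnW.
by case/card_gt0P => r /setD1P[rp rL]; exists r.
Qed.

(** A line meets itself in q points, and q is at least 2. *)
Lemma card_meet_neq L M : #|points L :&: points M| == 1%N -> L != M.
Proof.
apply: contraTneq => <-; rewrite finset.setIid card_line.
by have := card_finNzRing_gt1 F; case: #|F| => [|[|]].
Qed.

Lemma parallel_refl L : parallel L L.
Proof. by have [v Lv] := line_direction L; apply/parallelP; exists v. Qed.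

Lemma parallel_sym L M : parallel L M = parallel M L.
Proof. by apply/parallelP/parallelP => -[v]; exists v. Qed.

Lemma parallel_direction L M v : parallel L M -> direction L v -> direction M v.
Proof.
move=> /parallelP[w Lw Mw] Lv; apply: direction_eqmx Mw _ _; first by case: Lv.
exact: direction_sub Lw Lv.
Qed.

Lemma parallel_trans : transitive (@parallel F n).
Proof.
move=> M L T LM /parallelP[v Mv Tv]; apply/parallelP; exists v => //.
by apply: parallel_direction Mv; rewrite parallel_sym.
Qed.

Lemma parallel_meet L M p :
  parallel L M -> p \in points L -> p \in points M -> L = M.
Proof.
case/parallelP => v [_ Lv] [_ Mv] pL pM.
by apply/val_inj/setP => x /=; rewrite (Lv _ pL) (Mv _ pM).
Qed.

Lemma direction_nparallel L M v w :
  direction L v -> direction M w -> ~~ parallel L M -> ~~ (v <= w)%MS.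
Proof.
move=> Lv Mw; apply: contra => vw; apply/parallelP; exists v => //.
by apply: direction_eqmx Mw _ vw; case: Lv.
Qed.

Lemma rank_adds_row m (A : 'M[F]_(m, n)) v :
  ~~ (v <= A)%MS -> \rank (A + v)%MS = (\rank A).+1.
Proof.
move=> vA; have v0 : v != 0 by apply: contraNneq vA => ->; apply: sub0mx.
apply/eqP; rewrite eqn_leq; apply/andP; split.
  by have := mxrank_adds_leqif A v; rewrite (rank_row v0) addn1 => -[].
apply: rank_ltmx.
by rewrite ltmxE addsmxSl /= addsmx_sub submx_refl.
Qed.

(** If r - p = a v + b w, then p + a v = r - b w is a point of both lines. *)
Lemma meet_of_span L M v w p r :
  direction L v -> direction M w -> p \in points L -> r \in points M ->
  (r - p <= v + w)%MS -> exists2 x, x \in points L & x \in points M.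
Proof.
move=> [_ Lv] [_ Mw] pL rM /sub_addsmxP[u rpE]; exists (p + u.1 *m v).
  by rewrite (Lv _ pL) addrC addKr submxMl.
rewrite (Mw _ rM).
have -> : p + u.1 *m v - r = - (u.2 *m w).
  rewrite -[r](subrK p) rpE [X in _ - X]addrC opprD addrACA subrr add0r.
  by rewrite opprD addrA subrr add0r.
by rewrite eqmx_opp submxMl.
Qed.

(** * Lines inside flats, and the planes and 3-spaces spanned by lines *)

Lemma flat_sub_direction S L v (U : 'M[F]_n) :
  (forall p, p \in S -> forall x, (x \in S) = (x - p <= U)%MS) ->
  points L \subset S -> direction L v -> (v <= U)%MS.
Proof.
move=> SU LS [_ Lv]; have [p pL] := line_point L.
have: p + v \in S by apply: (fintype.subsetP LS); rewrite (Lv _ pL) addrC addKr.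
by rewrite (SU p (fintype.subsetP LS _ pL)) addrC addKr.
Qed.

Lemma direction_sub_flat S L v p (U : 'M[F]_n) :
  (forall p, p \in S -> forall x, (x \in S) = (x - p <= U)%MS) ->
  p \in S -> p \in points L -> direction L v -> (v <= U)%MS -> points L \subset S.
Proof.
move=> SU pS pL [_ Lv] vU; apply/fintype.subsetP => x.
by rewrite (Lv _ pL) (SU _ pS) => /submx_trans; apply.
Qed.

Lemma flat_line d S L p r : is_flat d S -> p \in S -> r \in S ->
  p \in points L -> r \in points L -> p != r -> points L \subset S.
Proof.
case/flat_rebase => U _ SU pS rS pL rL pr.
apply: (direction_sub_flat SU pS pL (direction_diff pL rL pr)).
by rewrite -(SU _ pS).
Qed.

Lemma flat_parallel d S L M p : is_flat d S -> points L \subset S -> parallel L M ->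
  p \in S -> p \in points M -> points M \subset S.
Proof.
case/flat_rebase => U _ SU LS /parallelP[v Lv Mv] pS pM.
exact: (direction_sub_flat SU pS pM Mv (flat_sub_direction SU LS Lv)).
Qed.

Lemma flat_parallel_through d S L p : is_flat d S -> points L \subset S -> p \in S ->
  exists2 M, parallel L M /\ p \in points M & points M \subset S.
Proof.
move=> fS LS pS; have [v Lv] := line_direction L.
have [M pM Mv] := line_through p Lv.1.
have LM : parallel L M by apply/parallelP; exists v.
by exists M => //; apply: flat_parallel fS LS LM pS pM.
Qed.

(** Two independent directions span the whole rank 2 direction space of the plane, so [meet_of_span]
    applies to any point of [L] and any point of [M]. *)
Lemma coplanar_meet P L M : is_flat 2 P -> points L \subset P -> points M \subset P ->
  ~~ parallel L M -> exists2 p, p \in points L & p \in points M.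
Proof.
case/flat_rebase => U rU PU LP MP nLM.
have [v Lv] := line_direction L; have [w Mw] := line_direction M.
have [p pL] := line_point L; have [r rM] := line_point M.
apply: (meet_of_span Lv Mw pL rM).
have wv : ~~ (w <= v)%MS by apply: direction_nparallel Mw Lv _; rewrite parallel_sym.
have vwU : (v + w <= U)%MS.
  by rewrite addsmx_sub !(flat_sub_direction PU _ Lv, flat_sub_direction PU _ Mw).
have rvw : \rank (v + w)%MS = \rank U by rewrite rank_adds_row // rU rank_row //; case: Lv.
have /leqifP := mxrank_leqif_sup vwU; rewrite rvw ltnn; case: ifP => // Uvw _.
apply: submx_trans Uvw; rewrite -(PU _ (fintype.subsetP LP _ pL)).
exact: (fintype.subsetP MP).
Qed.

Lemma plane_through L p : p \notin points L ->
  exists2 P, is_flat 2 P & points L \subset P /\ p \in P.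
Proof.
move=> pL; have [v Lv] := line_direction L; have [r rL] := line_point L.
have rk : \rank (v + (p - r))%MS = 2%N.
  by rewrite rank_adds_row ?rank_row -?(Lv.2 _ rL) //; case: Lv.
have := coset_flat r (v + (p - r))%MS; rewrite rk => fP.
exists (coset r (v + (p - r))%MS) => //.
split; last by rewrite mem_coset addsmxSr.
apply/fintype.subsetP => x; rewrite mem_coset (Lv.2 _ rL) => xv.
by apply: submx_trans xv _; apply: addsmxSl.
Qed.

Lemma plane_of_meeting L M p : L != M -> p \in points L -> p \in points M ->
  exists2 P, is_flat 2 P & points L \subset P /\ points M \subset P.
Proof.
move=> LM pL pM; have [r rM rp] := line_other_point M p.
have rL : r \notin points L by apply: contra rp => rL; rewrite (line_meet LM rL pL rM pM).
have [P fP [LP rP]] := plane_through rL; exists P => //; split=> //.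
by apply: (flat_line fP rP (fintype.subsetP LP _ pL) rM pM).
Qed.

Lemma plane_of_parallel L M : L != M -> parallel L M ->
  exists2 P, is_flat 2 P & points L \subset P /\ points M \subset P.
Proof.
move=> LM LpM; have [r rM] := line_point M.
have rL : r \notin points L.
  by apply: contra LM => rL; rewrite (parallel_meet LpM rL rM).
have [P fP [LP rP]] := plane_through rL; exists P => //; split=> //.
exact: flat_parallel fP LP LpM rP rM.
Qed.

Lemma solid_of_skew L M : Defs.skew L M ->
  exists2 S, is_flat 3 S & points L \subset S /\ points M \subset S.
Proof.
case/andP => dLM nLM.
have [v Lv] := line_direction L; have [w Mw] := line_direction M.
have [p pL] := line_point L; have [r rM] := line_point M.
have wv : ~~ (w <= v)%MS by apply: direction_nparallel Mw Lv _; rewrite parallel_sym.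
(* A dependence between [v], [w] and [r - p] would make the two lines meet; hence these vectors span
   a space of rank 3. *)
have rpvw : ~~ (r - p <= v + w)%MS.
  apply/negP => /(meet_of_span Lv Mw pL rM)[x xL xM].
  by have := disjointFr dLM xL; rewrite xM.
have rk : \rank (v + w + (r - p))%MS = 3%N.
  by rewrite !rank_adds_row // rank_row //; case: Lv.
have fS := coset_flat p (v + w + (r - p))%MS; rewrite rk in fS.
have SU x := coset_rebase x (_ : _ \in coset p (v + w + (r - p))%MS).
have rS : r \in coset p (v + w + (r - p))%MS by rewrite mem_coset addsmxSr.
exists (coset p (v + w + (r - p))%MS) => //; split.
  apply: (direction_sub_flat _ (coset_self _ _) pL Lv) => [s sS x|]; first exact: SU.
  by apply: submx_trans (addsmxSl _ _); apply: addsmxSl.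
apply: (direction_sub_flat _ rS rM Mw) => [s sS x|]; first exact: SU.
by apply: submx_trans (addsmxSl _ _); apply: addsmxSr.
Qed.

End Geometry.

(** * Grids, and counting the lines that cross a given line *)

Section Grids.
Variables (F : finFieldType) (n : nat).
Implicit Types (L M N T : line F n) (p r : 'rV[F]_n) (P S : {set 'rV[F]_n}).
Implicit Types (A B D Q : {set line F n}).

Definition disjoint_lines D : Prop := forall L M p, L \in D -> M \in D ->
  p \in points L -> p \in points M -> L = M.

Definition covers B A : Prop := forall L p, L \in A -> p \in points L ->
  exists2 M, M \in B & p \in points M.

(* The common shape of both kinds of support: two rulings of one set of q^2 points. *)
Record grid A B : Prop := Grid {
  grid_neq0 : A != finset.set0;
  grid_coverl : covers B A;
  grid_coverr : covers A B;
  grid_meet : forall L M, L \in A -> M \in B -> #|points L :&: points M| == 1%N;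
  grid_disjl : disjoint_lines A;
  grid_disjr : disjoint_lines B }.

Lemma grid_sym A B : grid A B -> grid B A.
Proof.
case=> A0 AB BA mAB dA dB; split=> //.
  have /set0Pn[L LA] := A0; have [p pL] := line_point L.
  by have [M MB _] := AB L p LA pL; apply/set0Pn; exists M.
by move=> L M LB MA; rewrite finset.setIC mAB.
Qed.

Section Transversal.
Variables (T : line F n) (D : {set line F n}).

Section Covered.
Hypotheses (TD : T \notin D) (DT : forall p, p \in points T -> exists2 M, M \in D & p \in points M).

(** A choice of a line of [D] through each point of [T]; by [DT] the default is never taken there.
    It is injective on [T], since a line of [D] through two points of [T] would be [T] itself, which
    is not in [D]. *)
Let g p := odflt T [pick M in D | p \in points M].

Let gP p : p \in points T -> g p \in D /\ p \in points (g p).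
Proof.
move=> pT; rewrite /g; case: pickP => [M /andP[] //|no].
by have [M MD pM] := DT pT; have := no M; rewrite MD pM.
Qed.

Let g_inj : {in points T &, injective g}.
Proof.
move=> p r pT rT gpr; apply: contraNeq TD => pr.
have [gD pg] := gP pT; have [_ rg] := gP rT; rewrite -gpr in rg.
by rewrite (line_eq pT rT pg rg pr).
Qed.

Let gT_sub : g @: points T \subset D.
Proof. by apply/fintype.subsetP => _ /imsetP[p pT ->]; case: (gP pT). Qed.

Lemma card_cover : (#|F| <= #|D|)%N.
Proof. by rewrite -(card_line T) -(card_in_imset g_inj) subset_leq_card. Qed.

(** With only q lines available, [g] is a bijection from the points of [T] to [D]: no line of [D] is
    left over and no point of [T] carries two of them. *)
Lemma card_cover_exact : #|D| = #|F| ->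
  (forall M, M \in D -> #|points T :&: points M| == 1%N) /\
  forall M N p, M \in D -> N \in D -> p \in points T ->
    p \in points M -> p \in points N -> M = N.
Proof.
move=> cD; have DE : g @: points T = D.
  by apply/eqP; rewrite eqEcard gT_sub cD (card_in_imset g_inj) card_line /=.
have DgP M : M \in D -> exists2 p, p \in points T & M = g p.
  by rewrite -DE => /imsetP[p pT ->]; exists p.
have TN M : M \in D -> T != M by apply: contraTneq => <-.
split=> [M MD|M N p MD ND pT pM pN].
  have [p pT ME] := DgP M MD; apply: (card_meet (TN M MD) pT).
  by rewrite ME; case: (gP pT).
suff gE M' : M' \in D -> p \in points M' -> M' = g p by rewrite (gE M) // (gE N).
move=> M'D pM'; have [r rT M'E] := DgP M' M'D; rewrite M'E.
have rM' : r \in points M' by rewrite M'E; case: (gP rT).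
by rewrite (line_meet (TN _ M'D) rT pT rM' pM').
Qed.

(** Here surjectivity of [g] comes from geometry instead of counting: a line of [D] meets [T] in
    some [p], and by disjointness it is the chosen line [g p]. *)
Lemma card_disjoint_cover :
  (forall M, M \in D -> #|points T :&: points M| == 1%N) -> disjoint_lines D ->
  #|D| = #|F|.
Proof.
move=> mT dD; rewrite -(card_line T) -(card_in_imset g_inj).
apply/eqP; rewrite eqn_leq (subset_leq_card gT_sub) andbT; apply: subset_leq_card.
apply/fintype.subsetP => M MD; have [p pT pM] := meet_point (mT M MD).
apply/imsetP; exists p => //; have [gD pg] := gP pT.
exact: dD MD gD pM pg.
Qed.

End Covered.

(** Counting in the other direction: sending a line of [D] to its point on [T] is injective by
    disjointness, and q lines then use up all q points of [T]. *)
Lemma meet_cover :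
  (forall M, M \in D -> #|points T :&: points M| == 1%N) -> disjoint_lines D ->
  #|D| = #|F| ->
  forall p, p \in points T -> exists2 M, M \in D & p \in points M.
Proof.
move=> mT dD cD p pT; have [p0 p0T] := line_point T.
pose h M := odflt p0 [pick r in points T :&: points M].
have hP M : M \in D -> h M \in points T /\ h M \in points M.
  move=> MD; rewrite /h; case: pickP => [r /setIP[] //|no].
  have [r rT rM] := meet_point (mT M MD).
  by have := no r; rewrite inE rT rM.
have h_inj : {in D &, injective h}.
  move=> M N MD ND hE; have [_ hM] := hP M MD; have [_ hN] := hP N ND.
  by apply: (dD M N (h M)) => //; rewrite hE.
have hD : h @: D = points T.
  apply/eqP; rewrite eqEcard (card_in_imset h_inj) cD card_line leqnn andbT.
  by apply/fintype.subsetP => _ /imsetP[M MD ->]; case: (hP M MD).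
have /imsetP[M MD ->] : p \in h @: D by rewrite hD.
by exists M => //; case: (hP M MD).
Qed.

End Transversal.

(** * Grids inside a flat: parallel classes against skew families *)

Lemma grid_notin A B L : grid A B -> L \in A -> L \notin B.
Proof.
move=> g LA; apply/negP => LB.
by have := card_meet_neq (grid_meet g LA LB); rewrite eqxx.
Qed.

Lemma grid_card A B : grid A B -> #|B| = #|F|.
Proof.
move=> g; have /set0Pn[L LA] := grid_neq0 g.
apply: (@card_disjoint_cover L) (grid_disjr g).
- exact: grid_notin g LA.
- by move=> p; apply: (grid_coverl g LA).
- by move=> M MB; apply: (grid_meet g).
Qed.

(** Distinct classes have different directions, so coplanarity makes their lines meet; the covering
    conditions come from the parallel to a given line through a given point. *)
Lemma parallel_classes_grid A B : distinct_parallel_classes A B -> grid A B.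
Proof.
case=> P [fP [L0 L0P AE] [M0 M0P BE] AB].
have nLM : ~~ parallel L0 M0.
  apply: contra AB => LM; apply/eqP; rewrite AE BE; apply/setP => N; rewrite !inE.
  case: (_ \subset _) => //=; apply/idP/idP; apply: parallel_trans => //.
  by rewrite parallel_sym.
have inA N : (N \in A) = (points N \subset P) && parallel L0 N by rewrite AE inE.
have inB N : (N \in B) = (points N \subset P) && parallel M0 N by rewrite BE inE.
have nAB N N' : N \in A -> N' \in B -> ~~ parallel N N'.
  rewrite inA inB => /andP[_ LN] /andP[_ MN']; apply: contra nLM => NN'.
  by apply: parallel_trans LN (parallel_trans NN' _); rewrite parallel_sym.
split.
- by apply/set0Pn; exists L0; rewrite inA L0P parallel_refl.
- move=> L p; rewrite inA => /andP[LP _] pL.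
  have [M [LM pM] MP] := flat_parallel_through fP M0P (fintype.subsetP LP _ pL).
  by exists M; rewrite // inB MP.
- move=> M p; rewrite inB => /andP[MP _] pM.
  have [L [ML pL] LP] := flat_parallel_through fP L0P (fintype.subsetP MP _ pM).
  by exists L; rewrite // inA LP.
- move=> L M LA MB; have nL := nAB L M LA MB.
  move: LA MB; rewrite inA inB => /andP[LP _] /andP[MP _].
  have [p pL pM] := coplanar_meet fP LP MP nL; apply: card_meet pL pM.
  by apply: contraNneq nL => ->; apply: parallel_refl.
- move=> L M p; rewrite !inA => /andP[_ L0L] /andP[_ L0M]; apply: parallel_meet.
  by apply: parallel_trans L0M; rewrite parallel_sym.
- move=> L M p; rewrite !inB => /andP[_ L0L] /andP[_ L0M]; apply: parallel_meet.
  by apply: parallel_trans L0M; rewrite parallel_sym.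
Qed.

(** A line of [B] meets the disjoint lines [L] and [M] in two different points of [S], so it lies in
    [S]; every point of a line of [A] is on such a line. *)
Lemma grid_in_flat d A B L M S : grid A B -> L \in A -> M \in A -> L != M ->
  is_flat d S -> points L \subset S -> points M \subset S ->
  forall N, N \in A :|: B -> points N \subset S.
Proof.
move=> g LA MA LM fS LS MS.
have BS N : N \in B -> points N \subset S.
  move=> NB; have [p pL pN] := meet_point (grid_meet g LA NB).
  have [r rM rN] := meet_point (grid_meet g MA NB).
  apply: (flat_line fS (fintype.subsetP LS _ pL) (fintype.subsetP MS _ rM) pN rN).
  apply: contra LM => /eqP prE; rewrite -prE in rM.
  by rewrite (grid_disjl g LA MA pL rM).
move=> N /setUP[NA|]; last exact: BS.
apply/fintype.subsetP => p pN; have [K KB pK] := grid_coverl g NA pN.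
exact: (fintype.subsetP (BS K KB)).
Qed.

(** Disjoint lines of a plane are parallel, so [A] lies in one class. It is the full class: a
    parallel [M] of [L] in [P] meets a line of [B], and the line of [A] through that point is
    parallel to [M], hence equal to it. *)
Lemma plane_grid_class P A B : grid A B -> is_flat 2 P ->
  (forall N, N \in A :|: B -> points N \subset P) -> parallel_class P A.
Proof.
move=> g fP gP; have /set0Pn[L LA] := grid_neq0 g.
have AP N : N \in A -> points N \subset P by move=> NA; apply: gP; rewrite inE NA.
exists L; first exact: AP.
have AL N : N \in A -> parallel L N.
  move=> NA; case: (boolP (parallel L N)) => // nLN.
  have [p pL pN] := coplanar_meet fP (AP L LA) (AP N NA) nLN.
  by rewrite (grid_disjl g LA NA pL pN) parallel_refl in nLN.
apply/setP => M; rewrite inE; apply/idP/andP => [MA|[MP LM]]; first by rewrite AP ?AL.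
have /set0Pn[N NB] := grid_neq0 (grid_sym g).
have mLN := grid_meet g LA NB; have [r rL rN] := meet_point mLN.
have nLN : ~~ parallel L N.
  by apply: contra (card_meet_neq mLN) => LN; rewrite (parallel_meet LN rL rN).
have nMN : ~~ parallel M N by apply: contra nLN; apply: parallel_trans.
have NP : points N \subset P by apply: gP; rewrite inE NB orbT.
have [p pM pN] := coplanar_meet fP MP NP nMN.
have [K KA pK] := grid_coverr g NB pN.
suff -> : M = K by [].
apply: (parallel_meet _ pM pK); apply: parallel_trans (AL K KA).
by rewrite parallel_sym.
Qed.

Lemma grid_neq A B : grid A B -> A != B.
Proof.
move=> g; have /set0Pn[L LA] := grid_neq0 g; have := grid_notin g LA.
by apply: contraNneq => <-.
Qed.

Lemma distinct_parallel_classes_sym A B :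
  distinct_parallel_classes A B -> distinct_parallel_classes B A.
Proof. by case=> P [fP cA cB AB]; exists P; rewrite eq_sym. Qed.

Lemma grid_parallel A B L M : grid A B -> L \in A -> M \in A -> L != M ->
  parallel L M -> distinct_parallel_classes A B.
Proof.
move=> g LA MA LM pLM; have [P fP [LP MP]] := plane_of_parallel LM pLM.
have gP := grid_in_flat g LA MA LM fP LP MP.
exists P; split; [by [] | exact: plane_grid_class gP | | exact: grid_neq].
by apply: (plane_grid_class (grid_sym g) fP) => N; rewrite finset.setUC; apply: gP.
Qed.

(** The lines of [A] are disjoint already, so skewness can fail only through a parallel pair, which
    forces the whole grid into a plane. *)
Lemma grid_skewl A B : grid A B ->
  distinct_parallel_classes A B \/ pairwise_skew A.
Proof.
move=> g; case: (pselect (distinct_parallel_classes A B)) => [|nAB]; [by left | right].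
move=> L M LA MA LM; apply/andP; split.
  apply/pred0P => p /=; apply: contraNF LM => /andP[pL pM].
  by rewrite (grid_disjl g LA MA pL pM).
by apply/negP => pLM; apply: nAB; apply: grid_parallel LM pLM.
Qed.

Lemma grid_dichotomy A B : grid A B ->
  distinct_parallel_classes A B \/ pairwise_skew A /\ pairwise_skew B.
Proof.
move=> g; have [dAB|sA] := grid_skewl g; first by left.
have [/distinct_parallel_classes_sym dAB|sB] := grid_skewl (grid_sym g); first by left.
by right.
Qed.

Lemma grid_card_gt1 A B : grid A B -> (1 < #|A|)%N.
Proof. by move=> /grid_sym/grid_card ->; apply: card_finNzRing_gt1. Qed.

(** As q is at least 2, a class contains two distinct lines, and these are parallel. *)
Lemma parallel_classes_not_skew A B :
  distinct_parallel_classes A B -> ~ pairwise_skew A.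
Proof.
move=> dAB; have /grid_card_gt1/card_gt1P[L [M [LA MA LM]]] := parallel_classes_grid dAB.
move=> /(_ L M LA MA LM)/andP[_ /negP]; apply.
case: dAB => P [_ [L0 _ AE] _ _]; move: LA MA; rewrite AE !inE => /andP[_ pL] /andP[_].
by apply: parallel_trans; rewrite parallel_sym.
Qed.

(** * Transversals of skew lines, and affine reguli as grids *)

Lemma skew_disjoint_lines D : pairwise_skew D -> disjoint_lines D.
Proof.
move=> sD L M p LD MD pL pM; apply/eqP; case: (boolP (L == M)) => // LM.
by have /andP[/pred0P/(_ p) /=] := sD L M LD MD LM; rewrite pL pM.
Qed.

(** Since [p] is off [L], the line [L] meets [T] and [T'] in two different points of the plane. *)
Lemma meeting_lines_sub P T T' L p : is_flat 2 P -> points T \subset P ->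
  points T' \subset P -> T != T' -> p \in points T -> p \in points T' ->
  p \notin points L -> #|points T :&: points L| == 1%N ->
  #|points T' :&: points L| == 1%N -> points L \subset P.
Proof.
move=> fP TP T'P TT' pT pT' pL /meet_point[a aT aL] /meet_point[b bT' bL].
apply: (flat_line fP (fintype.subsetP TP _ aT) (fintype.subsetP T'P _ bT') aL bL).
apply: contra TT' => /eqP abE; rewrite -abE in bT'.
rewrite (line_eq pT aT pT' bT') //.
by apply: contraNneq pL => ->.
Qed.

(** Two transversals through [p] would span a plane containing both [L] and [M], and coplanar lines
    are not skew. *)
Lemma skew_transversal_unique L M T T' p : Defs.skew L M ->
  p \notin points L -> p \notin points M -> p \in points T -> p \in points T' ->
  #|points T :&: points L| == 1%N -> #|points T :&: points M| == 1%N ->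
  #|points T' :&: points L| == 1%N -> #|points T' :&: points M| == 1%N -> T = T'.
Proof.
case/andP => dLM nLM pL pM pT pT' TL TM T'L T'M.
apply/eqP; case: (boolP (T == T')) => // TT'.
have [P fP [TP T'P]] := plane_of_meeting TT' pT pT'.
have LP := meeting_lines_sub fP TP T'P TT' pT pT' pL TL T'L.
have MP := meeting_lines_sub fP TP T'P TT' pT pT' pM TM T'M.
have [x xL xM] := coplanar_meet fP LP MP nLM.
by have := disjointFr dLM xL; rewrite xM.
Qed.

Lemma transversalsP Q T :
  reflect (forall L, L \in Q -> #|points T :&: points L| == 1%N) (T \in transversals Q).
Proof. by rewrite inE; apply: (iffP forall_inP). Qed.

(** The point [p] lies on one line of [Q]; more than two lines leave a skew pair avoiding [p], to
    which [skew_transversal_unique] applies. *)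
Lemma transversal_unique Q T T' p : (2 < #|Q|)%N -> pairwise_skew Q ->
  covers Q (transversals Q) ->
  T \in transversals Q -> T' \in transversals Q ->
  p \in points T -> p \in points T' -> T = T'.
Proof.
move=> cQ sQ Qcov TQ T'Q pT pT'; have [L LQ pL] := Qcov T p TQ pT.
move: cQ; rewrite (cardsD1 L) LQ => /card_gt1P[M [N [/setD1P[ML MQ] /setD1P[NL NQ] MN]]].
have off K : K \in Q -> K != L -> p \notin points K.
  move=> KQ KL; apply: contra KL => pK.
  by rewrite (skew_disjoint_lines sQ KQ LQ pK pL).
have /transversalsP tT := TQ; have /transversalsP tT' := T'Q.
by apply: (@skew_transversal_unique M N T T' p); rewrite ?off ?tT ?tT' //; apply: sQ.
Qed.

Lemma grid_transversals A B : grid A B -> B \subset transversals A.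
Proof.
move=> g; apply/fintype.subsetP => M MB; apply/transversalsP => L LA.
by rewrite finset.setIC (grid_meet g).
Qed.

Lemma covers_transversals D : disjoint_lines D -> #|D| = #|F| -> covers D (transversals D).
Proof.
move=> dD cD T p /transversalsP tT pT.
exact: (meet_cover tT dD cD pT).
Qed.

(** The second regulus condition concerns all transversals, not only those in [B]; it holds because
    a transversal meets q disjoint lines in q different points, which are all its points. *)
Lemma grid_regulus S A B : grid A B -> pairwise_skew A ->
  (forall L, L \in A -> points L \subset S) -> affine_regulus S A.
Proof.
move=> g sA AS; split=> //; first by split=> //; apply: grid_neq0 g.
  move=> L p LA pL; have [M MB pM] := grid_coverl g LA pL; exists M => //.
  exact: (fintype.subsetP (grid_transversals g)).
apply: covers_transversals; first exact: grid_disjl g.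
exact: grid_card (grid_sym g).
Qed.

Lemma skew_grid_flat A B : grid A B -> pairwise_skew A ->
  exists2 S, is_flat 3 S & forall L, L \in A :|: B -> points L \subset S.
Proof.
move=> g sA; have /card_gt1P[L [M [LA MA LM]]] := grid_card_gt1 g.
have [S fS [LS MS]] := solid_of_skew (sA L M LA MA LM); exists S => //.
exact: grid_in_flat g LA MA LM fS LS MS.
Qed.

Lemma skew_grid_opposite_pair A B : grid A B -> pairwise_skew A -> pairwise_skew B ->
  opposite_pair A B.
Proof.
move=> g sA sB; have [S fS gS] := skew_grid_flat g sA; exists S; split=> //.
- by apply: grid_regulus g sA _ => L LA; apply: gS; rewrite inE LA.
- by apply: grid_regulus (grid_sym g) sB _ => L LB; apply: gS; rewrite inE LB orbT.
- exact: grid_transversals.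
Qed.

Lemma skew_grid_regulus A B : grid A B -> pairwise_skew A -> affine_regulus_in_3flat A.
Proof.
move=> g sA; have [S fS gS] := skew_grid_flat g sA; exists S => //.
by apply: grid_regulus g sA _ => L LA; apply: gS; rewrite inE LA.
Qed.

(** A transversal shares a point of [A] with some line of [B], itself a transversal; for q > 2 only
    one transversal passes through that point. *)
Lemma skew_grid_opposite A B : (2 < #|F|)%N -> grid A B -> pairwise_skew A ->
  opposite_regulus A = B.
Proof.
move=> q2 g sA; have sB := grid_transversals g; have cA := grid_card (grid_sym g).
apply/eqP; rewrite finset.eqEsubset sB andbT; apply/fintype.subsetP => T TA.
have /set0Pn[L LA] := grid_neq0 g; have /transversalsP tT := TA.
have [p pT pL] := meet_point (tT L LA); have [M MB pM] := grid_coverl g LA pL.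
rewrite (@transversal_unique A T M p) ?cA //; last exact: (fintype.subsetP sB).
exact: covers_transversals (grid_disjl g) cA.
Qed.

(** The q points of any one transversal correspond to the lines of [Q]. *)
Lemma regulus_card S Q : affine_regulus S Q -> #|Q| = #|F|.
Proof.
case=> -[/set0Pn[L LQ] _] sQ cQ cT; have [p pL] := line_point L.
have [T TQ pT] := cQ L p LQ pL; have /transversalsP tT := TQ.
apply: (@card_disjoint_cover T); last exact: skew_disjoint_lines.
- by apply/negP => /tT /card_meet_neq; rewrite eqxx.
- by move=> r; apply: cT TQ.
- exact: tT.
Qed.

Lemma regulus_grid S Q : (2 < #|F|)%N -> affine_regulus S Q -> grid Q (opposite_regulus Q).
Proof.
move=> q2 RQ; have cQ := regulus_card RQ; case: RQ => -[Q0 _] sQ cov cT; split=> //.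
- by move=> L T LQ /transversalsP tT; rewrite finset.setIC tT.
- exact: skew_disjoint_lines.
- by move=> T T' p TQ T'Q pT pT'; apply: (@transversal_unique Q T T' p); rewrite ?cQ.
Qed.

Lemma opposite_pair_skew Q Q' : opposite_pair Q Q' -> pairwise_skew Q /\ pairwise_skew Q'.
Proof. by case=> S [_ [_ ? _ _] [_ ? _ _] _]. Qed.

(** Both families have q disjoint lines and cross each other once, so [meet_cover] supplies both
    coverings, whatever q is. *)
Lemma opposite_pair_grid Q Q' : opposite_pair Q Q' -> grid Q Q'.
Proof.
move=> QQ'; have [/skew_disjoint_lines dQ /skew_disjoint_lines dQ'] := opposite_pair_skew QQ'.
case: QQ' => S [_ RQ RQ' QQ'].
have meet T L : T \in Q' -> L \in Q -> #|points T :&: points L| == 1%N.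
  by move=> /(fintype.subsetP QQ')/transversalsP; apply.
split=> //; first by case: RQ => -[].
- move=> L p LQ pL; apply: (@meet_cover L Q'); rewrite ?(regulus_card RQ') //.
  by move=> M MQ'; rewrite finset.setIC meet.
- move=> T p TQ' pT; apply: (@meet_cover T Q); rewrite ?(regulus_card RQ) //.
  by move=> L LQ; apply: meet.
- by move=> L M LQ MQ'; rewrite finset.setIC meet.
Qed.

End Grids.

(** * An explicit skew grid: the two rulings of a hyperbolic paraboloid *)

Section Paraboloid.
Variables (F : finFieldType) (n : nat).
Implicit Types (i j k : 'I_n) (a b s t : F) (L M : line F n).

(** The point of the surface z = xy with x = a and y = t, where x, y, z are the coordinates [i],
    [j], [k]. *)
Definition saddle i j k a t : 'rV[F]_n :=
  a *: delta_mx 0 i + t *: delta_mx 0 j + (a * t) *: delta_mx 0 k.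

(** The lines x = a on the surface, each given by its points with y = 0 and y = 1. Exchanging [i]
    and [j] gives the other ruling. *)
Definition ruling i j k : {set line F n} :=
  [set L : line F n | [exists a,
    (saddle i j k a 0 \in points L) && (saddle i j k a 1 \in points L)]]%SET.

Lemma saddleC i j k a t : saddle i j k a t = saddle j i k t a.
Proof. by rewrite /saddle mulrC [X in X + _]addrC. Qed.

Lemma saddleE i j k a t l :
  saddle i j k a t 0 l = a *+ (l == i) + t *+ (l == j) + (a * t) *+ (l == k).
Proof. by rewrite !mxE !eqxx /= !mulr_natr. Qed.

Section Distinct.
Variables i j k : 'I_n.
Hypotheses (ij : i != j) (ik : i != k) (jk : j != k).

Lemma saddle_inj a t b s : saddle i j k a t = saddle i j k b s -> a = b /\ t = s.
Proof.
move=> E; have := congr1 (fun x : 'rV_n => x 0 i) E; have := congr1 (fun x : 'rV_n => x 0 j) E.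
rewrite !saddleE !eqxx (negPf ij) (negPf ik) (negPf jk) eq_sym (negPf ij).
by rewrite !mulr0n !mulr1n !addr0 !add0r => -> ->.
Qed.

Lemma ruling_param L : L \in ruling i j k ->
  exists a, direction L (saddle i j k a 1 - saddle i j k a 0) /\
    forall x, x \in points L <-> exists t, x = saddle i j k a t.
Proof.
rewrite inE => /existsP[a /andP[L0 L1]]; exists a.
have neq01 : saddle i j k a 0 != saddle i j k a 1.
  by apply/eqP => /saddle_inj[_ /eqP]; rewrite eq_sym oner_eq0.
have dL := direction_diff L0 L1 neq01; split=> // x; rewrite (dL.2 _ L0).
have dE t : saddle i j k a t - saddle i j k a 0 =
    t *: (saddle i j k a 1 - saddle i j k a 0).
  by apply/rowP => l; rewrite !mxE; ring.
split=> [/sub_rVP[t xE]|[t ->]]; last by rewrite dE scalemx_sub.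
by exists t; rewrite -[LHS](subrK (saddle i j k a 0)) xE -dE subrK.
Qed.

Lemma ruling_line a : exists2 L, L \in ruling i j k &
  forall t, saddle i j k a t \in points L.
Proof.
have neq01 : saddle i j k a 1 - saddle i j k a 0 != 0.
  by rewrite subr_eq0; apply/eqP => /saddle_inj[_ /eqP]; rewrite oner_eq0.
have [L L0 dL] := line_through (saddle i j k a 0) neq01.
have L1 : saddle i j k a 1 \in points L by rewrite (dL.2 _ L0).
have LR : L \in ruling i j k by rewrite inE; apply/existsP; exists a; rewrite L0 L1.
exists L => // t; have [b [_ Lb]] := ruling_param LR.
have /Lb[s /saddle_inj[-> _]] := L0; by apply/Lb; exists t.
Qed.

Lemma ruling_disjoint : disjoint_lines (ruling i j k).
Proof.
move=> L M p /ruling_param[a [_ La]] /ruling_param[b [_ Mb]] /La[t ->] /Mb[s].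
case/saddle_inj => ab _; rewrite -ab in Mb; apply/val_inj/setP => x /=.
by apply/idP/idP => [/La/Mb|/Mb/La].
Qed.

Lemma ruling_skew : pairwise_skew (ruling i j k).
Proof.
move=> L M LR MR LM; apply/andP; split.
  apply/pred0P => p /=; apply: contraNF LM => /andP[pL pM].
  by rewrite (ruling_disjoint LR MR pL pM).
apply: contra LM => pLM.
have [a [dL La]] := ruling_param LR; have [b [dM Mb]] := ruling_param MR.
(* The line with parameter a has direction e_j + a e_k. Comparing the coordinates [j] forces [c] to
   be 1, and the coordinates [k] then force equal parameters. *)
have /sub_rVP[c E] := direction_sub (parallel_direction pLM dL) dM.
have Ej := congr1 (fun x : 'rV_n => x 0 j) E.
have Ek := congr1 (fun x : 'rV_n => x 0 k) E.
move: Ej Ek; rewrite !mxE !eqxx /= (negPf jk) [k == i]eq_sym (negPf ik).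
rewrite [k == j]eq_sym (negPf jk) [j == i]eq_sym (negPf ij) /=.
rewrite !(mulr0, mulr1, addr0, add0r, subr0) => <-; rewrite mul1r => ba.
rewrite ba in Mb; apply/eqP/val_inj/setP => x /=.
by apply/idP/idP => [/La/Mb|/Mb/La].
Qed.

End Distinct.

Lemma ruling_covers i j k : i != j -> i != k -> j != k ->
  covers (ruling j i k) (ruling i j k).
Proof.
move=> ij ik jk L p /(ruling_param ij ik jk)[a [_ La]] /La[t ->].
have ji : j != i by rewrite eq_sym.
have [M MR Mt] := ruling_line ji jk ik t; exists M => //.
by rewrite saddleC.
Qed.

Lemma ruling_grid i j k : i != j -> i != k -> j != k ->
  grid (ruling i j k) (ruling j i k).
Proof.
move=> ij ik jk; have ji : j != i by rewrite eq_sym.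
split; try exact: ruling_covers; try exact: ruling_disjoint.
  by have [L LR _] := ruling_line ij ik jk 0; apply/set0Pn; exists L.
move=> L M /(ruling_param ij ik jk)[a [_ La]] /(ruling_param ji jk ik)[b [_ Mb]].
apply: (@card_meet _ _ L M (saddle i j k a b)).
(* Coordinate [j] is constantly [b] on [M] but takes the value [b + 1] on [L]. *)
- apply/eqP => LM; have /Mb[s] : saddle i j k a (b + 1) \in points M.
    by rewrite -LM; apply/La; exists (b + 1).
  rewrite saddleC => /(saddle_inj ji jk ik)[/eqP].
  by rewrite -subr_eq0 addrC addKr oner_eq0.
- by apply/La; exists b.
- by apply/Mb; exists a; rewrite saddleC.
Qed.

End Paraboloid.

Lemma skew_grid_exists (F : finFieldType) (n : nat) : (3 <= n)%N ->
  exists A B : {set line F n}, [/\ grid A B, pairwise_skew A & pairwise_skew B].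
Proof.
case: n => [|[|[|n]]] // _.
pose i : 'I_n.+3 := ord0; pose j : 'I_n.+3 := inord 1; pose k : 'I_n.+3 := inord 2.
have ij : i != j by rewrite -val_eqE /= inordK.
have ik : i != k by rewrite -val_eqE /= inordK.
have jk : j != k by rewrite -val_eqE /= !inordK.
exists (ruling F i j k), (ruling F j i k); split.
- exact: ruling_grid.
- exact: ruling_skew.
- by apply: ruling_skew; rewrite // eq_sym.
Qed.

(** Two crossing lines of the skew grid span a plane and have different directions there. *)
Lemma distinct_parallel_classes_exist (F : finFieldType) (n : nat) : (3 <= n)%N ->
  exists A B : {set line F n}, distinct_parallel_classes A B.
Proof.
case/(skew_grid_exists F) => A [B [g _ _]].
have /set0Pn[L LA] := grid_neq0 g; have /set0Pn[M MB] := grid_neq0 (grid_sym g).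
have mLM := grid_meet g LA MB; have [p pL pM] := meet_point mLM.
have LM := card_meet_neq mLM; have [P fP [LP MP]] := plane_of_meeting LM pL pM.
exists [set N : line F n | (points N \subset P) && parallel L N]%SET.
exists [set N : line F n | (points N \subset P) && parallel M N]%SET.
exists P; split=> //; [by exists L | by exists M |].
apply: contra LM => /eqP/setP/(_ L); rewrite !inE LP parallel_refl /= => /esym pML.
by rewrite (parallel_meet pML pM pL).
Qed.

(** * Eigenfunctions as functions with zero sum at every point; the weight bound and its equality
    case *)

Section Eigenfunctions.
Variables (R : realType) (F : finFieldType) (n : nat).
Implicit Types (f g : {ffun line F n -> R}) (L M N : line F n) (p : 'rV[F]_n).
Implicit Types (A B Q : {set line F n}).

Local Notation X := (line_graph F n).
Local Notation q := #|F|.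
Local Notation theta := (- q%:R : R).

Definition point_sum f p : R := \sum_(L | p \in points L) f L.

(** The identity N^T N = A + q, read at [L]: the term of [L] is counted at each of its q points,
    that of another line once if it meets [L] and never otherwise. *)
Lemma sum_point_sum f L :
  \sum_(p in points L) point_sum f p = q%:R * f L + \sum_(M | X L M) f M.
Proof.
rewrite /point_sum; under eq_bigr do rewrite big_mkcond /=.
rewrite exchange_big /= (bigD1 L) //=; congr (_ + _).
  rewrite -(card_line L) -big_mkcondr /= (eq_bigl (mem (points L))) ?sumr_const.
    by rewrite mulr_natl.
  by move=> p; rewrite andbb.
rewrite [RHS]big_mkcond [LHS]big_mkcond /=; apply: eq_bigr => M _.
rewrite /line_graph eq_sym; case: (eqVneq L M) => //= LM.
rewrite -big_mkcondr /=.
case: (set0Pn (points L :&: points M)) => [[p /setIP[pL pM]]|no]; last first.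
  by rewrite big_pred0 // => p; apply/negP => pLM; apply: no; exists p; rewrite inE.
rewrite (big_pred1 p) // => r; apply/andP/eqP => [[rL rM]|-> //].
exact: line_meet LM rL pL rM pM.
Qed.

Lemma eigenfunctionP f : eigenfunction X theta f <->
  (exists L, f L != 0) /\ forall p, point_sum f p = 0.
Proof.
split=> -[f0 fE]; split=> //; last first.
  move=> L; have := sum_point_sum f L.
  by rewrite big1 // mulNr => /esym/eqP; rewrite addrC addr_eq0 => /eqP ->.
have s0 L : \sum_(p in points L) point_sum f p = 0.
  by rewrite sum_point_sum -fE mulNr subrr.
(* The squared norm of N f equals the inner product of f with N^T N f, which is 0; over the reals
   every term of the sum of squares vanishes. *)
have : \sum_p point_sum f p ^+ 2 = 0.
  rewrite (eq_bigr (fun p => \sum_(L | p \in points L) point_sum f p * f L)); last first.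
    by move=> p _; rewrite expr2 {2}/point_sum mulr_sumr.
  rewrite (exchange_big_dep predT) //= big1 // => L _.
  by rewrite -mulr_suml s0 mul0r.
move/eqP; rewrite psumr_eq0 => [/allP z p|p _]; last exact: sqr_ge0.
by have := z p (mem_index_enum p); rewrite sqrf_eq0 => /eqP.
Qed.

Lemma point_sumN f p : point_sum [ffun L => - f L] p = - point_sum f p.
Proof. by rewrite /point_sum -sumrN; apply: eq_bigr => L _; rewrite ffunE. Qed.

Definition pos_lines f : {set line F n} := [set L | 0 < f L]%SET.
Definition neg_lines f : {set line F n} := [set L | f L < 0]%SET.

Lemma pos_linesN f : pos_lines [ffun L => - f L] = neg_lines f.
Proof. by apply/setP => L; rewrite !inE ffunE oppr_gt0. Qed.

Lemma neg_linesN f : neg_lines [ffun L => - f L] = pos_lines f.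
Proof. by apply/setP => L; rewrite !inE ffunE oppr_lt0. Qed.

Lemma pos_neg_disjoint f : [disjoint pos_lines f & neg_lines f].
Proof.
by apply/pred0P => L /=; rewrite !inE; case: (ltgtP (f L) 0).
Qed.

Lemma weightE f : weight f = (#|pos_lines f| + #|neg_lines f|)%N.
Proof.
rewrite -cardsUI (disjoint_setI0 (pos_neg_disjoint f)) cards0 addn0.
by apply: eq_card => L; rewrite !inE orbC -neq_lt.
Qed.

(** A zero sum with a positive term also has a negative one. *)
Lemma neg_covers f : (forall p, point_sum f p = 0) -> covers (neg_lines f) (pos_lines f).
Proof.
move=> fE L p; rewrite inE => fL pL.
case: (pickP (fun M => (p \in points M) && (f M < 0))) => [M /andP[pM fM]|no].
  by exists M; rewrite ?inE.
suff : 0 < point_sum f p by rewrite fE ltxx.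
rewrite /point_sum (bigD1 L) //= ltr_pwDl //; apply: sumr_ge0 => M /andP[pM _].
by have := no M; rewrite pM /= => /negbT; rewrite -leNgt.
Qed.

Lemma pos_covers f : (forall p, point_sum f p = 0) -> covers (pos_lines f) (neg_lines f).
Proof.
move=> fE; have := @neg_covers [ffun L => - f L].
by rewrite pos_linesN neg_linesN; apply=> p; rewrite point_sumN fE oppr0.
Qed.

Lemma covers_card A B : A != finset.set0 -> [disjoint A & B] -> covers B A -> (q <= #|B|)%N.
Proof.
move=> /set0Pn[L LA] dAB cAB; apply: (@card_cover _ _ L).
  by rewrite (disjointFr dAB LA).
by move=> p; apply: cAB LA.
Qed.

Lemma pos_neg_neq0 f : eigenfunction X theta f ->
  pos_lines f != finset.set0 /\ neg_lines f != finset.set0.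
Proof.
case/eigenfunctionP => -[L]; rewrite neq_lt => fL fE; have [p pL] := line_point L.
have cP := neg_covers fE; have cN := pos_covers fE.
case/orP: fL => fL; split; apply/set0Pn.
- have LN : L \in neg_lines f by rewrite inE.
  by have [M] := cN L p LN pL; exists M.
- by exists L; rewrite inE.
- by exists L; rewrite inE.
- have LP : L \in pos_lines f by rewrite inE.
  by have [M] := cP L p LP pL; exists M.
Qed.

Lemma pos_neg_card f : eigenfunction X theta f ->
  (q <= #|pos_lines f|)%N /\ (q <= #|neg_lines f|)%N.
Proof.
move=> fE; have [P0 N0] := pos_neg_neq0 fE; have /eigenfunctionP[_ fS] := fE.
split; first by apply: covers_card N0 _ (pos_covers fS); rewrite disjoint_sym pos_neg_disjoint.
exact: covers_card P0 (pos_neg_disjoint f) (neg_covers fS).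
Qed.

Lemma weight_bound f : eigenfunction X theta f -> (2 * q <= weight f)%N.
Proof. by case/pos_neg_card => qP qN; rewrite weightE mul2n -addnn leq_add. Qed.

Lemma min_weight_grid f : eigenfunction X theta f -> weight f = (2 * q)%N ->
  grid (pos_lines f) (neg_lines f).
Proof.
move=> fE wf; have [qP qN] := pos_neg_card fE; have [P0 N0] := pos_neg_neq0 fE.
have [cP cN] : #|pos_lines f| = q /\ #|neg_lines f| = q.
  (* Both numbers are at least q and their sum is 2q. *)
  by move: wf; rewrite weightE; lia.
have /eigenfunctionP[_ fS] := fE; have PN := neg_covers fS; have NP := pos_covers fS.
have dPN L : L \in pos_lines f -> L \notin neg_lines f.
  by move=> LP; rewrite (disjointFr (pos_neg_disjoint f) LP).
have dNP L : L \in neg_lines f -> L \notin pos_lines f.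
  by move=> LN; rewrite (disjointFl (pos_neg_disjoint f) LN).
have exP L (LP : L \in pos_lines f) := card_cover_exact (dPN L LP) (PN L ^~ LP) cN.
have exN L (LN : L \in neg_lines f) := card_cover_exact (dNP L LN) (NP L ^~ LN) cP.
split=> //.
- by move=> L M LP; apply: (exP L LP).1.
(* A negative line [N] passes through [p], and by exactness each point of [N] lies on only one
   positive line. *)
- move=> L M p LP MP pL pM; have [N NN pN] := PN L p LP pL.
  exact: (exN N NN).2 p LP MP pN pL pM.
- move=> L M p LN MN pL pM; have [N NP' pN] := NP L p LN pL.
  exact: (exP N NP').2 p LN MN pN pL pM.
Qed.

Lemma takes_valuesE c A B f : grid A B -> takes_values c A B f ->
  forall L, f L = c * ((L \in A)%:R - (L \in B)%:R).
Proof.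
move=> g [fA fB f0] L; case: (boolP (L \in A)) => LA.
  by rewrite (negPf (grid_notin g LA)) subr0 mulr1 fA.
by case: (boolP (L \in B)) => LB; rewrite ?(fB L LB) ?(f0 L LA LB) sub0r ?oppr0 ?mulr0 ?mulrN1.
Qed.

Lemma takes_valuesN c A B f : takes_values c A B f -> takes_values (- c) B A f.
Proof. by case=> fA fB f0; split=> // L; [rewrite opprK; apply: fA | move=> *; apply: f0]. Qed.

Lemma pos_lines_grid c A B f : 0 < c -> grid A B -> takes_values c A B f ->
  pos_lines f = A /\ neg_lines f = B.
Proof.
move=> c0 g tf; have dAB L := @grid_notin _ _ A B L g.
have dBA L := @grid_notin _ _ B A L (grid_sym g).
split; apply/setP => L; rewrite inE (takes_valuesE g tf).
- rewrite pmulr_rgt0 //; case: (boolP (L \in A)) => [/dAB/negPf ->|_].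
    by rewrite subr0 ltr01.
  by rewrite sub0r oppr_gt0 ltNge ler0n.
- rewrite pmulr_rlt0 //; case: (boolP (L \in B)) => [/dBA/negPf ->|_].
    by rewrite sub0r oppr_lt0 ltr01.
  by rewrite subr0 ltNge ler0n.
Qed.

(** A point of the grid lies on exactly one line of each family, contributing c and -c; at any other
    point all terms are 0. *)
Lemma grid_eigenfunction c A B f : c != 0 -> grid A B -> takes_values c A B f ->
  eigenfunction X theta f /\ weight f = (2 * q)%N.
Proof.
(* A negative [c] is made positive by exchanging the two families. *)
wlog c0 : c A B / 0 < c => [H cn0|_] g tf.
  case: (ltgtP c 0) (cn0) => // c0 _; last exact: (H c A B).
  apply: (H (- c) B A); rewrite ?oppr_gt0 ?oppr_eq0 //; first exact: grid_sym.
  exact: takes_valuesN.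
have [pA nB] := pos_lines_grid c0 g tf; split; last first.
  by rewrite weightE pA nB (grid_card g) (grid_card (grid_sym g)) mul2n addnn.
case: (tf) => fA fB f0; apply/eigenfunctionP; split.
  by have /set0Pn[L LA] := grid_neq0 g; exists L; rewrite fA // gt_eqF.
move=> p; case: (pickP (fun L => (L \in A) && (p \in points L))) => [L /andP[LA pL]|noA].
  have [M MB pM] := grid_coverl g LA pL; have LM := card_meet_neq (grid_meet g LA MB).
  rewrite /point_sum (bigD1 L) //= (bigD1 M) /=; last by rewrite pM eq_sym.
  rewrite big1 => [|N /andP[/andP[pN NL] NM]]; first by rewrite fA // fB // addr0 subrr.
  apply: f0.
    by apply: contra NL => NA; rewrite (grid_disjl g NA LA pN pL).
  by apply: contra NM => NB; rewrite (grid_disjr g NB MB pN pM).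
rewrite /point_sum big1 // => L pL; apply: f0.
  by apply/negP => LA; have := noA L; rewrite LA pL.
apply/negP => LB; have [M MA pM] := grid_coverr g LB pL.
by have := noA M; rewrite MA pM.
Qed.

Lemma min_weight_takes_values f : eigenfunction X theta f -> weight f = (2 * q)%N ->
  exists2 c, 0 < c & takes_values c (pos_lines f) (neg_lines f) f.
Proof.
move=> fE wf; have g := min_weight_grid fE wf; have /eigenfunctionP[_ fS] := fE.
(* At the common point of [L] and [M] every other line has value 0. As each positive line meets each
   negative one, these equations make f constant on each family. *)
have fPN L M : L \in pos_lines f -> M \in neg_lines f -> f L = - f M.
  move=> LP MN; have mLM := grid_meet g LP MN; have [p pL pM] := meet_point mLM.
  apply/eqP; rewrite -addr_eq0 -(fS p) /point_sum (bigD1 L) //= (bigD1 M) /=; last first.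
    by rewrite pM eq_sym (card_meet_neq mLM).
  rewrite big1 ?addr0 // => N /andP[/andP[pN NL] NM]; apply/eqP.
  case: (ltgtP (f N) 0) => // fN.
    by move: NM; rewrite (grid_disjr g _ MN pN pM) ?eqxx // inE.
  by move: NL; rewrite (grid_disjl g _ LP pN pL) ?eqxx // inE.
have /set0Pn[L LP] := grid_neq0 g; have /set0Pn[M MN] := grid_neq0 (grid_sym g).
exists (f L); first by rewrite inE in LP.
split=> [K KP|K KN|K]; first by rewrite (fPN K M) // (fPN L M).
  by rewrite (fPN L K) // opprK.
by rewrite !inE; case: ltgtP.
Qed.

Lemma signed_indicatorP A B : grid A B -> takes_values 1 A B (signed_indicator R A B).
Proof.
move=> g; split=> L; rewrite ffunE => LA; first by rewrite LA (negPf (grid_notin g LA)) subr0.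
  by rewrite LA (negPf (grid_notin (grid_sym g) LA)) sub0r.
by move=> /negPf ->; rewrite (negPf LA) subr0.
Qed.

Hypothesis n3 : (3 <= n)%N.

Lemma min_weight_eigenfunction_exists :
  exists2 f, eigenfunction X theta f & weight f = (2 * q)%N.
Proof.
have [A [B [g _ _]]] := skew_grid_exists F n3.
exists (signed_indicator R A B);
  by have [] := grid_eigenfunction (oner_neq0 _) g (signed_indicatorP g).
Qed.

Lemma optimalP f : optimal_eigenfunction X theta f <->
  eigenfunction X theta f /\ weight f = (2 * q)%N.
Proof.
split=> [[fE fmin]|[fE wf]]; split=> //; last by move=> g gE; rewrite wf weight_bound.
have [g gE wg] := min_weight_eigenfunction_exists.
by apply/eqP; rewrite eqn_leq weight_bound // andbT -wg fmin.
Qed.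

Lemma grid_optimal c A B f : c != 0 -> grid A B -> takes_values c A B f ->
  optimal_eigenfunction X theta f.
Proof. by move=> c0 g tf; apply/optimalP; apply: grid_eigenfunction tf. Qed.

Lemma optimal_grid f : optimal_eigenfunction X theta f ->
  grid (pos_lines f) (neg_lines f) /\
  exists2 c, 0 < c & takes_values c (pos_lines f) (neg_lines f) f.
Proof.
move=> /optimalP[fE wf]; split; first exact: min_weight_grid.
exact: min_weight_takes_values.
Qed.

(** * Rays of optimal eigenfunctions and the families of grids that index them *)

Lemma ray_self f : ray f f.
Proof. by exists 1 => //; apply/ffunP => L; rewrite ffunE mul1r. Qed.

Lemma ray_scale f (c : R) : 0 < c -> ray [ffun L => c * f L] = ray f.
Proof.
move=> c0; apply/seteqP; split=> g [d d0 ->].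
  by exists (d * c); [apply: mulr_gt0 | apply/ffunP => L; rewrite !ffunE mulrA].
exists (d / c); first exact: divr_gt0.
by apply/ffunP => L; rewrite !ffunE mulrA divfK // gt_eqF.
Qed.

Lemma takes_values_ray c A B f : 0 < c -> grid A B -> takes_values c A B f ->
  ray f = ray (signed_indicator R A B).
Proof.
move=> c0 g tf; rewrite -(ray_scale (signed_indicator R A B) c0); congr ray.
by apply/ffunP => L; rewrite !ffunE (takes_valuesE g tf).
Qed.

(* An exchange-stable family of grids, parametrised by [h1] and [h2]; for
   reguli the parameter is the first ruling alone. *)
Section Family.
Variables (I : Type) (D : I -> Prop) (h1 h2 : I -> {set line F n}).
Variable K : {ffun line F n -> R} -> Prop.
Hypothesis Dgrid : forall i, D i -> grid (h1 i) (h2 i).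
Hypothesis Dswap : forall i, D i -> exists j, [/\ D j, h1 j = h2 i & h2 j = h1 i].
Hypothesis h_inj : forall i j, D i -> D j -> h1 i = h1 j -> h2 i = h2 j -> i = j.
Hypothesis KP : forall f, K f <-> exists c i,
  [/\ c != 0, D i & takes_values c (h1 i) (h2 i) f].

Lemma family_optimal f : K f -> optimal_eigenfunction X theta f.
Proof. by move=> /KP[c [i [c0 /Dgrid Di]]]; apply: grid_optimal. Qed.

Lemma family_pos f : K f -> exists c i,
  [/\ 0 < c, D i & takes_values c (h1 i) (h2 i) f].
Proof.
move=> /KP[c [i [cn0 Di tf]]]; case: (ltgtP c 0) cn0 => // c0 _; last by exists c, i.
have [j [Dj j1 j2]] := Dswap Di; exists (- c), j; rewrite oppr_gt0 j1 j2; split=> //.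
exact: takes_valuesN.
Qed.

Lemma family_pos_neg f : K f -> exists i,
  [/\ D i, pos_lines f = h1 i & neg_lines f = h2 i].
Proof.
case/family_pos => c [i [c0 Di tf]]; exists i.
by have [] := pos_lines_grid c0 (Dgrid Di) tf.
Qed.

Lemma family_signed_indicator i : D i -> K (signed_indicator R (h1 i) (h2 i)).
Proof.
move=> Di; apply/KP; exists 1, i; split=> //; first exact: oner_neq0.
exact/signed_indicatorP/Dgrid.
Qed.

(** A positive multiple keeps the sets of positive and negative lines, so a ray determines both
    families and hence the parameter. Surjectivity uses [Dswap] to turn a negative scalar into a
    positive one. *)
Lemma family_rays : set_bij [set i | D i]%classic
  [set r | exists f, [/\ optimal_eigenfunction X theta f, K f & r = ray f]]%classic
  (fun i => ray (signed_indicator R (h1 i) (h2 i))).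
Proof.
split.
- move=> i /= /family_signed_indicator Ki; exists (signed_indicator R (h1 i) (h2 i)).
  by split=> //; apply: family_optimal.
- move=> i j; rewrite !in_setE /= => Di Dj ij.
  have := ray_self (signed_indicator R (h1 j) (h2 j)).
  rewrite -ij => -[c c0 jE].
  have ti : takes_values c (h1 i) (h2 i) (signed_indicator R (h1 j) (h2 j)).
    have [t1 t2 t3] := signed_indicatorP (Dgrid Di).
    split=> [L LA|L LB|L LA LB]; rewrite jE ffunE.
    - by rewrite t1 ?mulr1.
    - by rewrite t2 ?mulrN1.
    - by rewrite t3 ?mulr0.
  have [i1 i2] := pos_lines_grid c0 (Dgrid Di) ti.
  have [j1 j2] := pos_lines_grid ltr01 (Dgrid Dj) (signed_indicatorP (Dgrid Dj)).
  by apply: h_inj; rewrite // -?i1 -?i2 ?j1 ?j2.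
- move=> _ [f [_ Kf ->]]; have [c [i [c0 Di tf]]] := family_pos Kf.
  by exists i => //; rewrite (takes_values_ray c0 (Dgrid Di) tf).
Qed.

End Family.

(** The second alternative is stated for skew grids, which become reguli with their transversals
    when q > 2 and opposite pairs when q = 2. *)
Lemma optimal_first_type_or_skew f : optimal_eigenfunction X theta f ->
  first_type f \/ exists c A B, [/\ c != 0, grid A B, pairwise_skew A, pairwise_skew B
    & takes_values c A B f].
Proof.
case/optimal_grid => g [c c0 tf]; have cn0 : c != 0 by rewrite gt_eqF.
case: (grid_dichotomy g) => [dAB|[sA sB]]; [left | right];
  by exists c, (pos_lines f), (neg_lines f).
Qed.

End Eigenfunctions.

(** * The eigenvalue of the adjacency matrix, and the classification into two types *)

Lemma line_graph_sym (F : finFieldType) n : symmetric (line_graph F n).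
Proof. by move=> L M; rewrite /line_graph eq_sym finset.setIC. Qed.

(** [eigenvalue] refers to row vectors acting from the left, while eigenfunctions sum over the
    neighbours of a row index; symmetry reconciles the two. *)
Lemma eigenfunction_eigenvalue (R : realType) (V : finType) (adj : rel V) (theta : R) f :
  symmetric adj -> eigenfunction adj theta f -> eigenvalue (adjacency_matrix R adj) theta.
Proof.
move=> sadj [[u fu] fE]; apply/eigenvalueP; exists (\row_j f (enum_val j)).
  apply/rowP => j; rewrite !mxE fE [RHS]big_mkcond /=.
  rewrite [RHS](reindex (@enum_val V V)) /=; last by apply: onW_bij; apply: enum_val_bij.
  apply: eq_bigr => i _; rewrite !mxE sadj.
  by case: (adj _ _); rewrite ?mulr1 ?mulr0.
by apply/eqP => /rowP/(_ (enum_rank u)); rewrite !mxE enum_rankK; apply/eqP.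
Qed.

Theorem theorem1p2 (R : realType) (F : finFieldType) (q n : nat)
    (hq : #|F| = q) (hn : (3 <= n)%N) :
  let X := line_graph F n in
  let theta : R := - q%:R in
  let optimal := optimal_eigenfunction X theta in
  [/\ [/\ eigenvalue (adjacency_matrix R X) theta,
          forall f, eigenfunction X theta f -> (2 * q <= weight f)%N
        & exists2 f, eigenfunction X theta f & weight f = (2 * q)%N],
      (* first type *)
      [/\ exists2 f, optimal f & first_type f,
          forall f, first_type f -> optimal f
        & set_bij
            [set AB : {set line F n} * {set line F n} |
               distinct_parallel_classes AB.1 AB.2]%classic
            [set r | exists f, [/\ optimal f, first_type f & r = ray f]]%classic
            (fun AB => ray (signed_indicator R AB.1 AB.2))],
      (* second type and classification *)
      (2 < q)%N ->
        [/\ exists2 f, optimal f & second_type f,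
            forall f : {ffun line F n -> R}, ~ (first_type f /\ second_type f),
            forall f, optimal f <-> first_type f \/ second_type f
          & set_bij
              [set Q : {set line F n} | affine_regulus_in_3flat Q]%classic
              [set r | exists f,
                 [/\ optimal f, second_type f & r = ray f]]%classic
              (fun Q => ray (signed_indicator R Q (opposite_regulus Q)))]
    & (* the same for q = 2, where a regulus has two opposite reguli *)
      q = 2%N ->
        [/\ exists2 f, optimal f & second_type_binary f,
            forall f : {ffun line F n -> R},
              ~ (first_type f /\ second_type_binary f),
            forall f, optimal f <-> first_type f \/ second_type_binary f
          & set_bij
              [set QQ' : {set line F n} * {set line F n} |
                 opposite_pair QQ'.1 QQ'.2]%classic
              [set r | exists f,
                 [/\ optimal f, second_type_binary f & r = ray f]]%classic
              (fun QQ' => ray (signed_indicator R QQ'.1 QQ'.2))]].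
Proof.
move=> X theta optimal; subst q.
have dpc_swap (AB : {set line F n} * {set line F n}) : distinct_parallel_classes AB.1 AB.2 ->
    exists BA : {set line F n} * {set line F n},
      [/\ distinct_parallel_classes BA.1 BA.2, BA.1 = AB.2 & BA.2 = AB.1].
  by move=> /distinct_parallel_classes_sym; exists (AB.2, AB.1).
have pair_inj (AB CD : {set line F n} * {set line F n}) :
  AB.1 = CD.1 -> AB.2 = CD.2 -> AB = CD by case: AB CD => A B [C D] /= -> ->.
have dpc_grid (AB : {set line F n} * {set line F n}) :
  distinct_parallel_classes AB.1 AB.2 -> grid AB.1 AB.2 by apply: parallel_classes_grid.
have firstP (f : {ffun line F n -> R}) : first_type f <-> exists c AB,
    [/\ c != 0, distinct_parallel_classes AB.1 AB.2 & takes_values c AB.1 AB.2 f].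
  by split=> [[c [A [B]]]|[c [[A B]]]]; [exists c, (A, B) | exists c, A, B].
have first_optimal := family_optimal hn dpc_grid firstP.
(* This separates the types: the positive lines form a parallel class in the first type, and a
   regulus, hence a skew family, in the second. *)
have skewl_not_first (f : {ffun line F n -> R}) : first_type f -> ~ pairwise_skew (pos_lines f).
  move=> /(family_pos_neg dpc_grid dpc_swap firstP)[AB [dAB -> _]].
  exact: parallel_classes_not_skew dAB.
have [A0 [B0 dAB0]] := distinct_parallel_classes_exist F hn.
have [A1 [B1 [g1 sA1 sB1]]] := skew_grid_exists F hn.
have [f0 f0E f0w] := min_weight_eigenfunction_exists R F hn.
split.
- split; [|exact: weight_bound | by exists f0].
  exact: eigenfunction_eigenvalue (@line_graph_sym F n) f0E.
- split; [|exact: first_optimal|].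
    have K0 := @family_signed_indicator R _ _ _ _ _ _ _ dpc_grid firstP (A0, B0) dAB0.
    by exists (signed_indicator R A0 B0); first exact: first_optimal.
  by apply: (family_rays hn dpc_grid dpc_swap _ firstP) => AB CD _ _; apply: pair_inj.
- move=> q2.
  have reg_grid (Q : {set line F n}) : affine_regulus_in_3flat Q -> grid Q (opposite_regulus Q).
    by case=> S _ /(regulus_grid q2).
  have reg_skew (Q : {set line F n}) : affine_regulus_in_3flat Q -> pairwise_skew Q.
    by case=> S _ [].
  (* The exchange for q > 2: the transversals of [Q] form a regulus whose transversals are [Q]
     again. Their skewness follows from the dichotomy, as [Q] is skew. *)
  have reg_swap (Q : {set line F n}) : affine_regulus_in_3flat Q ->
      exists Q', [/\ affine_regulus_in_3flat Q', Q' = opposite_regulus Q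
        & opposite_regulus Q' = Q].
    move=> RQ; have gQ := reg_grid Q RQ; exists (opposite_regulus Q).
    have sQ' : pairwise_skew (opposite_regulus Q).
      case: (grid_dichotomy gQ) => [/parallel_classes_not_skew|[]//].
      by move/(_ (reg_skew Q RQ)).
    split=> //; first exact: skew_grid_regulus (grid_sym gQ) sQ'.
    exact: skew_grid_opposite (grid_sym gQ) sQ'.
  have secondP (f : {ffun line F n -> R}) : second_type f <-> exists c Q,
    [/\ c != 0, affine_regulus_in_3flat Q & takes_values c Q (opposite_regulus Q) f] by [].
  have second_optimal := family_optimal hn reg_grid secondP.
  split.
  + have R1 := skew_grid_regulus g1 sA1.
    have K1 := family_signed_indicator reg_grid secondP R1.
    by exists (signed_indicator R A1 (opposite_regulus A1)); first exact: second_optimal.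
  + move=> f [/skewl_not_first nf /(family_pos_neg reg_grid reg_swap secondP)[Q [RQ fQ _]]].
    by apply: nf; rewrite fQ; apply: reg_skew.
  + move=> f; split=> [/(optimal_first_type_or_skew hn)[|]|[/first_optimal|/second_optimal]//].
      by left.
    case=> c [A [B [c0 g sA _ tf]]]; right; exists c, A; split=> //.
      exact: skew_grid_regulus g sA.
    by rewrite (skew_grid_opposite q2 g sA).
  + by apply: (family_rays hn reg_grid reg_swap _ secondP).
- move=> _.
  have opp_grid (QQ' : {set line F n} * {set line F n}) :
    opposite_pair QQ'.1 QQ'.2 -> grid QQ'.1 QQ'.2 by apply: opposite_pair_grid.
  (* The parameter is now the ordered pair of reguli, and the exchange swaps its entries. *)
  have opp_swap (AB : {set line F n} * {set line F n}) : opposite_pair AB.1 AB.2 ->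
      exists BA : {set line F n} * {set line F n},
        [/\ opposite_pair BA.1 BA.2, BA.1 = AB.2 & BA.2 = AB.1].
    move=> oAB; exists (AB.2, AB.1); split=> //=; have [sA sB] := opposite_pair_skew oAB.
    exact: skew_grid_opposite_pair (grid_sym (opp_grid _ oAB)) sB sA.
  have secondP (f : {ffun line F n -> R}) : second_type_binary f <-> exists c QQ',
      [/\ c != 0, opposite_pair QQ'.1 QQ'.2 & takes_values c QQ'.1 QQ'.2 f].
    by split=> [[c [A [B]]]|[c [[A B]]]]; [exists c, (A, B) | exists c, A, B].
  have second_optimal := family_optimal hn opp_grid secondP.
  split.
  + have o1 := skew_grid_opposite_pair g1 sA1 sB1.
    have K1 := @family_signed_indicator R _ _ _ _ _ _ _ opp_grid secondP (A1, B1) o1.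
    by exists (signed_indicator R A1 B1); first exact: second_optimal.
  + move=> f [/skewl_not_first nf /(family_pos_neg opp_grid opp_swap secondP)[QQ' [oQ fQ _]]].
    by apply: nf; rewrite fQ; case: (opposite_pair_skew oQ).
  + move=> f; split=> [/(optimal_first_type_or_skew hn)[|]|[/first_optimal|/second_optimal]//].
      by left.
    case=> c [A [B [c0 g sA sB tf]]]; right; exists c, A, B; split=> //.
    exact: skew_grid_opposite_pair.
  + by apply: (family_rays hn opp_grid opp_swap _ secondP) => AB CD _ _; apply: pair_inj.
Qed.
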